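(* For the complete graph $K_n$ of order $n\geq 2$, $$\gamma_{tm}(K_n)=\begin{cases}\lfloor 2n/3\rfloor & \text{if } n\equiv 0 \pmod 3,\\ \lfloor 2n/3\rfloor+1 & \text{if } n\equiv 1,2 \pmod 3.\end{cases}$$
   Context: $K_n$ is the complete graph with $n$ vertices. A total mixed dominating set of a finite simple graph $G=(V,E)$ with minimum degree at least $1$ is a set $S\subseteq V\cup E$ such that every element of $V\cup E$ (including those in $S$) is adjacent or incident to an element of $S$ (two vertices are adjacent if joined by an edge; two distinct edges are adjacent if they share an endpoint; a vertex and an edge are incident if the vertex is an endpoint of the edge; no element is adjacent or incident to itself). The total mixed domination number $\gamma_{tm}(G)$ is the minimum cardinality of a total mixed dominating set. *)

(* Defs.v *)
From HB Require Import structures.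
From mathcomp Require Import all_boot.
Set Implicit Arguments.
Unset Strict Implicit.
Unset Printing Implicit Defensive.

Record sgraph := SGraph {
  vertex :> finType;
  vadj : rel vertex;
  vadj_sym : symmetric vadj;
  vadj_irrefl : irreflexive vadj }.

Section MixedDomination.
Variable G : sgraph.
Implicit Types u v : G.

Definition edges : {set {set G}} :=
  [set [set p.1; p.2] | p in [pred p : G * G | vadj p.1 p.2]].

Definition edge : finType := {A : {set G} | A \in edges}.

Definition degree v : nat := #|[set u | vadj v u]|.

(* The disjoint union of the vertex set and the edge set. *)
Definition elt : finType := (G + edge)%type.

Definition mixed_adj (x y : elt) : bool :=
  match x, y with
  | inl u, inl v => vadj u v
  | inl u, inr e => u \in val e
  | inr e, inl u => u \in val e
  | inr e, inr f => (e != f) && (val e :&: val f != set0)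
  end.

Definition total_mixed_dominating (D : {set elt}) : bool :=
  [forall x, [exists y in D, mixed_adj x y]].

(* The whole of V + E only serves as the witness required by [arg min]; it is
   total mixed dominating as soon as the minimum degree is at least 1. *)
Definition gamma_tm : nat :=
  #|[arg min_(D < [set: elt] | total_mixed_dominating D) #|D|]|.

Lemma total_mixed_dominating_setT :
  (forall v, 0 < degree v) -> total_mixed_dominating [set: elt].
Proof.
move=> deg_gt0; apply/forallP=> -[v|[A EA]].
- have /card_gt0P[u] := deg_gt0 v; rewrite inE => vu.
  by apply/existsP; exists (inl u); rewrite inE.
- have /imsetP[[u v] /= _ defA] := EA.
  by apply/existsP; exists (inl u); rewrite inE /= defA !inE eqxx.
Qed.

Lemma gamma_tmP (deg_gt0 : forall v, 0 < degree v) :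
  (exists2 D, total_mixed_dominating D & #|D| = gamma_tm) /\
  (forall D, total_mixed_dominating D -> gamma_tm <= #|D|).
Proof.
rewrite /gamma_tm; case: arg_minnP => [|D domD minD].
  exact: total_mixed_dominating_setT.
by split=> //; exists D.
Qed.

End MixedDomination.

Section CompleteGraph.
Variable n : nat.

Definition complete_rel : rel 'I_n := fun i j => i != j.

Lemma complete_rel_sym : symmetric complete_rel.
Proof. by move=> i j; rewrite /complete_rel eq_sym. Qed.

Lemma complete_rel_irrefl : irreflexive complete_rel.
Proof. by move=> i; rewrite /complete_rel eqxx. Qed.

Definition complete_graph : sgraph :=
  SGraph complete_rel_sym complete_rel_irrefl.

Lemma degree_complete_graph (v : complete_graph) : degree v = n.-1.
Proof.
have -> : n.-1 = #|predC1 v| by rewrite cardC1 card_ord.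
by rewrite /degree; apply: eq_card => u; rewrite !inE /= eq_sym.
Qed.

End CompleteGraph.

(* Main.v *)
Require Import Defs.
From mathcomp Require Import all_boot.
From mathcomp Require Import zify.

(** Both cases of the formula say that gamma_tm (K_n) is 2n/3 rounded up.

    Lower bound (dominating_card_ge), by discharging.  Let D be total mixed
    dominating, and call a vertex touched when it lies in D or on an edge of D.
    Every element of D has 3 units to give away.  A vertex of D keeps all of
    them.  An edge of D gives 1 unit to each endpoint, and one unit more to an
    endpoint that no other element of D touches.  An edge of D cannot have two
    such endpoints, since it is itself dominated by an element of D incident or
    adjacent to it; so it gives away at most 3 units (sum_share_le3) and the
    charges of the vertices add up to at most 3|D| (sum_charge_le).  A touched
    vertex receives at least 2 units, in any graph.

    In K_n at most one vertex z is untouched, because an edge with both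
    endpoints untouched would not be dominated.  If there is none, the total
    charge is at least 2n.  If there is one, the 2 units that z lacks are found
    elsewhere: only a vertex w of D can dominate z, it holds 3 units, and what
    dominates w provides a further surplus unit, either to w through an edge of
    D or at another vertex of D.  Hence 2n <= 3|D| in all cases.

    Upper bound (small_dom_dominates).  Write n = 3q + s with s in {2, 3, 4}.
    Take a path with two edges on each of q disjoint triples of vertices, and
    among the s remaining vertices take 2, 2 or 3 of them as elements of D.
    Two vertices of D dominate every vertex.  At most one vertex is untouched,
    so every edge of K_n has a touched endpoint, and the two edges of a path
    dominate each other. *)

Set Implicit Arguments.
Unset Strict Implicit.

Lemma edgeP (G : sgraph) (e : edge G) :
  exists u v : G, vadj u v /\ val e = [set u; v].
Proof.
by case: e => A /= /imsetP[[u v]]; rewrite inE /= => uv ->; exists u, v.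
Qed.

Lemma edge_of_adj (G : sgraph) (u v : G) :
  vadj u v -> exists e : edge G, val e = [set u; v].
Proof.
move=> uv; have uvE : [set u; v] \in edges G by apply/imsetP; exists (u, v).
by exists (exist (fun A => A \in edges G) [set u; v] uvE).
Qed.

Lemma edges_meeting_adj (G : sgraph) (e f : edge G) (w : G) :
  e != f -> w \in val e -> w \in val f -> mixed_adj (inr e) (inr f).
Proof.
by move=> nef we wf; rewrite /= nef; apply/set0Pn; exists w; rewrite inE we.
Qed.

(** * Discharging a dominating set onto the vertices *)

Section Discharging.
Variables (G : sgraph) (D : {set elt G}).
Implicit Types (u v w : G) (e f : edge G).

Definition dom_degree v := \sum_(e | inr e \in D) (v \in val e).

(** What an edge of D gives to its endpoint v: 2 units if it is the only
    element of D that touches v, and 1 unit otherwise. *)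
Definition share v := 1 + ((inl v \notin D) && (dom_degree v == 1)).

Definition charge v := 3 * (inl v \in D) + dom_degree v * share v.

Lemma dom_degree_gt0 v e : inr e \in D -> v \in val e -> 0 < dom_degree v.
Proof. by move=> De ve; rewrite /dom_degree (bigD1 e) //= ve. Qed.

Lemma dom_degree_gt1 v e f : inr e \in D -> inr f \in D -> e != f ->
  v \in val e -> v \in val f -> 1 < dom_degree v.
Proof.
move=> De Df nef ve vf; rewrite /dom_degree (bigD1 e) //= ve.
by rewrite (bigD1 f) /= ?vf ?Df 1?eq_sym.
Qed.

Lemma charge_ge2 v : (inl v \in D) || (0 < dom_degree v) -> 1 < charge v.
Proof. by rewrite /charge /share; case: (_ \in D) => /=; lia. Qed.

Lemma charge_vertex v : inl v \in D -> 3 + dom_degree v <= charge v.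
Proof. by rewrite /charge /share => -> /=; lia. Qed.

Hypothesis domD : total_mixed_dominating D.

Lemma dominator (x : elt G) : exists2 y, y \in D & mixed_adj x y.
Proof. by have /forallP/(_ x)/exists_inP := domD. Qed.

(** The element of D that dominates e touches an endpoint of e. *)
Lemma share_eq1 e : inr e \in D -> exists2 v, v \in val e & share v = 1.
Proof.
move=> De; have [[v|f] Dy /= adj] := dominator (inr e).
  by exists v; rewrite // /share Dy.
case/andP: adj => nef /set0Pn[v /setIP[ve vf]]; exists v => //.
have := dom_degree_gt1 De Dy nef ve vf.
by rewrite /share; case: eqP => [->|_]; rewrite ?andbF.
Qed.

Lemma sum_share_le3 e : inr e \in D -> \sum_(v in val e) share v <= 3.
Proof.
move=> De; have [w we w1] := share_eq1 De.
have share_le2 v : share v <= 2 by rewrite /share; case: (_ && _).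
have [u [v [uv eE]]] := edgeP e.
have nuv : u \notin [set v].
  by rewrite inE; apply: contraTneq uv => ->; rewrite vadj_irrefl.
rewrite eE big_setU1 //= big_set1.
have := share_le2 u; have := share_le2 v.
by move: we; rewrite eE !inE => /orP[]/eqP <-; rewrite w1; lia.
Qed.

(** Exchanging the summations regroups the charges by the element of D they
    come from. *)
Lemma sum_charge_le : \sum_v charge v <= 3 * #|D|.
Proof.
have -> : #|D| = \sum_v (inl v \in D) + \sum_(e | inr e \in D) 1.
  rewrite -sum1_card big_sumType /=; congr (_ + _).
  by rewrite big_mkcond; apply: eq_bigr => v _; case: (_ \in _).
rewrite big_split /= -big_distrr mulnDr leq_add2l big_distrr /=.
under eq_bigr => v _ do rewrite /dom_degree big_distrl /=.
rewrite exchange_big; apply: leq_sum => e De /=; rewrite muln1.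
apply: leq_trans (sum_share_le3 De).
rewrite [X in _ <= X]big_mkcond /=; apply: leq_sum => v _.
by case: (v \in _); rewrite ?mul1n.
Qed.

End Discharging.

(** * The lower bound for complete graphs *)

(** A deficit of 2 at z may be made up by surpluses of 1 at w and x.  Allowing
    w = x covers a surplus of 2 at a single vertex. *)
Lemma sum_ge_double_card (T : finType) (f : T -> nat) (z w x : T) :
  (forall v, 2 * (v != z) + (v == w) + (v == x) <= f v) ->
  2 * #|T| <= \sum_v f v.
Proof.
have sum_eq1 a : \sum_(v : T) (v == a) = 1.
  by rewrite (bigD1 a) //= eqxx big1 // => v /negPf->.
move=> le_f.
apply: (@leq_trans (\sum_v (2 * (v != z) + (v == w) + (v == x)))); last first.
  by apply: leq_sum.
rewrite 2!big_split /= !sum_eq1 -big_distrr /= -sum1_card.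
rewrite (bigD1 z) //= (bigD1 z (P := xpredT)) //= eqxx.
by rewrite [X in _ <= 2 * (_ + X) + _ + _](eq_bigr (fun=> 1)) => [|v ->]; lia.
Qed.

Section LowerBound.
Variables (n : nat) (D : {set elt (complete_graph n)}).
Hypothesis domD : total_mixed_dominating D.
Local Notation touched v := ((inl v \in D) || (0 < dom_degree D v)).

Lemma untouched_unique (u v : complete_graph n) :
  ~~ touched u -> ~~ touched v -> u = v.
Proof.
move=> uT vT; apply/eqP/negPn/negP => nuv.
have [e eE] := @edge_of_adj (complete_graph n) u v nuv.
have out w : w \in val e -> ~~ touched w.
  by rewrite eE !inE => /orP[]/eqP->.
have [[w|f] Dy /= adj] := dominator domD (inr e).
  by have := out w adj; rewrite Dy.
case/andP: adj => _ /set0Pn[w /setIP[we wf]].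
by have := out w we; rewrite (dom_degree_gt0 Dy wf) orbT.
Qed.

Lemma sum_charge_ge : 2 * n <= \sum_v charge D v.
Proof.
have cardK : #|complete_graph n| = n by rewrite card_ord.
rewrite -[X in 2 * X]cardK.
have [/forallP allT|] := boolP [forall v, touched v].
  rewrite mulnC -sum_nat_const; apply: leq_sum => v _.
  exact: charge_ge2.
case/forallPn=> z zT.
have touch v : v != z -> 1 < charge D v.
  move=> nvz; apply: charge_ge2; apply: contraNT nvz => vT.
  by apply/eqP/untouched_unique.
have [[w|e] Dy /= zw] := dominator domD (inl z); last first.
  by move: zT; rewrite (dom_degree_gt0 Dy zw) orbT.
have nzw : w != z by rewrite eq_sym.
have cw := charge_vertex Dy.
(* The second surplus unit depends on what dominates w. *)
have [[x|e] Dx /= wx] := dominator domD (inl w); last first.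
  have dw := dom_degree_gt0 Dx wx.
  apply: (@sum_ge_double_card _ _ z w w) => v.
  have [->|nvz] := eqVneq v z; first by rewrite eq_sym (negPf nzw).
  have [->|nvw] := eqVneq v w; first by lia.
  by have := touch v nvz.
have cx := charge_vertex Dx.
have nxz : x != z by apply: contraNneq zT => <-; rewrite Dx.
have nxw : x != w by rewrite eq_sym.
apply: (@sum_ge_double_card _ _ z w x) => v.
have [->|nvz] := eqVneq v z.
  by rewrite eq_sym (negPf nzw) eq_sym (negPf nxz).
have [->|nvw] := eqVneq v w; first by rewrite eq_sym (negPf nxw); lia.
have [->|nvx] := eqVneq v x; first by lia.
by have := touch v nvz.
Qed.

Lemma dominating_card_ge : 2 * n <= 3 * #|D|.
Proof. exact: leq_trans sum_charge_ge (sum_charge_le domD). Qed.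

End LowerBound.

(** * A small dominating set of the complete graph *)

Section UpperBound.
Variable m : nat.
Local Notation n := m.+2.
Local Notation K := (complete_graph n).
(* This q leaves n - 3q = 2 + m %% 3 vertices outside the triples, hence at
   least two; two vertices in the set are needed to dominate each other. *)
Local Notation q := (m %/ 3).

(** The default is the vertex u, which is reached only when u and v coincide. *)
Definition elt_of_pair (u v : K) : elt K :=
  if insub [set u; v] is Some e then inr e else inl u.

Lemma elt_of_pairP (u v : K) : u != v ->
  exists2 e : edge K, elt_of_pair u v = inr e & val e = [set u; v].
Proof.
move=> nuv; have [e eE] := @edge_of_adj K u v nuv; exists e => //.
by rewrite /elt_of_pair -eE valK.
Qed.

(** The triple {3i, 3i+1, 3i+2} has center 3i+1; the indices 2i and 2i+1 give
    the edges to 3i and to 3i+2.  From index 2q on, consecutive vertices are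
    listed starting with 3q, whence q + t.  Enumerating the elements makes the
    cardinality bound immediate, without any injectivity. *)
Definition small_elt (t : nat) : elt K :=
  if t < 2 * q
  then elt_of_pair (inord (3 * t./2 + 1)) (inord (3 * t./2 + 2 * odd t))
  else inl (inord (q + t)).

Definition small_dom : {set elt K} :=
  [set small_elt t | t : 'I_((2 * n + 2) %/ 3)].

Lemma card_small_dom : #|small_dom| <= (2 * n + 2) %/ 3.
Proof. by rewrite -[X in _ <= X]card_ord; apply: leq_imset_card. Qed.

Lemma mem_small_elt t : t < (2 * n + 2) %/ 3 -> small_elt t \in small_dom.
Proof. by move=> lt_t; apply/imsetP; exists (Ordinal lt_t). Qed.

(** The last vertex may be left out, except when only the two vertices 3q and
    3q+1 remain. *)
Lemma vertex_small_dom (v : K) :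
  3 * q <= v -> (v < n.-1) || (v < 3 * q + 2) -> inl v \in small_dom.
Proof.
move=> qv vn; have -> : inl v = small_elt (v - q).
  rewrite /small_elt ifF; last lia.
  by rewrite subnKC ?inord_val //; lia.
by apply: mem_small_elt; lia.
Qed.

Lemma path_small_dom i (b : bool) : i < q ->
  exists2 e : edge K, inr e \in small_dom
                    & val e = [set inord (3 * i + 1); inord (3 * i + 2 * b)].
Proof.
move=> iq; have tE : small_elt (b + i.*2) =
    elt_of_pair (inord (3 * i + 1)) (inord (3 * i + 2 * b)).
  rewrite /small_elt half_bit_double oddD odd_double addbF oddb ifT //.
  by case: (b); lia.
have nuv : inord (3 * i + 1) != inord (3 * i + 2 * b) :> 'I_n.
  by apply/eqP => /(congr1 val) /=; rewrite !inordK; case: (b); lia.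
have [e eE vE] := elt_of_pairP nuv; exists e => //.
by rewrite -eE -tE; apply: mem_small_elt; case: (b); lia.
Qed.

Lemma small_dom_dominates : total_mixed_dominating small_dom.
Proof.
apply/forallP => -[v|e]; apply/exists_inP.
  have [vq|vq] := eqVneq (nat_of_ord v) (3 * q).
    have q1 : 3 * q + 1 < n by lia.
    exists (inl (Ordinal q1)); first by apply: vertex_small_dom => /=; lia.
    by apply/eqP => /(congr1 (@nat_of_ord n)) /=; lia.
  have q0 : 3 * q < n by lia.
  exists (inl (Ordinal q0)); first by apply: vertex_small_dom => /=; lia.
  by apply/eqP => /(congr1 (@nat_of_ord n)) /=; lia.
(* Only the last vertex can be untouched, so an endpoint other than that one
   leads to an element of D. *)
have [v ve vn] : exists2 v : K, v \in val e & v < n.-1.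
  have [u [v [uv ->]]] := edgeP e.
  have [un|un] := ltnP u n.-1; first by exists u; rewrite // !inE eqxx.
  exists v; first by rewrite !inE eqxx orbT.
  have : nat_of_ord u != v by [].
  by have := ltn_ord u; have := ltn_ord v; rewrite /=; lia.
have [qv|vq] := leqP (3 * q) v.
  by exists (inl v) => //; apply: vertex_small_dom; rewrite ?vn.
pose i := v %/ 3; have iq : i < q by rewrite /i; lia.
have [e0 De0 e0E] := path_small_dom false iq.
have [e1 De1 e1E] := path_small_dom true iq.
have e01 : e0 != e1.
  apply/eqP => /(congr1 val); rewrite e0E e1E => /setP/(_ (inord (3 * i))).
  rewrite !inE addn0 eqxx orbT => /esym/orP[]/eqP/(congr1 val) /=.
    by rewrite !inordK; lia.
  by rewrite !inordK; lia.
have c0 : inord (3 * i + 1) \in val e0 by rewrite e0E !inE eqxx.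
have c1 : inord (3 * i + 1) \in val e1 by rewrite e1E !inE eqxx.
have vE : (v \in val e0) || (v \in val e1).
  rewrite e0E e1E !inE -!val_eqE /= !inordK; lia.
have [->|ne0] := eqVneq e e0.
  by exists (inr e1) => //; apply: edges_meeting_adj e01 c0 c1.
have [ee1|ne1] := eqVneq e e1.
  by exists (inr e0) => //; apply: edges_meeting_adj ne0 _ c0; rewrite ee1.
case/orP: vE => vf; [exists (inr e0)|exists (inr e1)] => //.
  exact: edges_meeting_adj ne0 ve vf.
exact: edges_meeting_adj ne1 ve vf.
Qed.

End UpperBound.

Unset Implicit Arguments.

Theorem proposition3p6 (n : nat) (hn : 2 <= n) :
  gamma_tm (complete_graph n) =
    if n %% 3 == 0 then (2 * n) %/ 3 else (2 * n) %/ 3 + 1.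
Proof.
have deg_gt0 (v : complete_graph n) : 0 < degree v.
  by rewrite degree_complete_graph; lia.
have [[D domD <-] minD] := gamma_tmP deg_gt0.
have lower := dominating_card_ge domD.
have upper : #|D| <= (2 * n + 2) %/ 3.
  case: n hn {deg_gt0} D domD minD {lower} => [|[|m]] // _ D _ minD.
  exact: leq_trans (minD _ (small_dom_dominates m)) (card_small_dom m).
(* Only 2n/3 rounded up satisfies both bounds. *)
by case: eqP; lia.
Qed.
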